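(* Let $K$ be a field of characteristic zero, let $n \ge 1$, let $\mathfrak{m} = (x_1,\dots,x_n) \subseteq K[x_1,\dots,x_n]$ and $R = K[x_1,\dots,x_n]/\mathfrak{m}^2$. Let $\mathcal{RB}_1$ be the set of Rota--Baxter operators of weight one on $R$. Then $\mathcal{RB}_1$ is isomorphic to the disjoint union of two copies of the variety of idempotent matrices in $M_n(K)$: $$\mathcal{RB}_1 \cong \bigl(\{0\} \times \mathcal{P}\bigr) \sqcup \bigl(\{-1\} \times \mathcal{P}\bigr), \qquad \mathcal{P} = \{ Q \in M_n(K) \mid Q^2 = Q\}.$$
   Context: A $K$-linear map $P : R \to R$ is a Rota--Baxter operator of weight one if $P(x)P(y) = P\bigl(xP(y) + P(x)y + xy\bigr)$ for all $x,y \in R$. $R = K \oplus V$ as a $K$-vector space, where $V=\mathfrak{m}/\mathfrak{m}^2$ is $n$-dimensional with basis the images $\bar x_1,\dots,\bar x_n$ of $x_1,\dots,x_n$, and $V \cdot V = 0$. Using the basis $1,\bar x_1,\dots,\bar x_n$ of $R$, $K$-linear maps $R\to R$ are identified with $(n+1)\times(n+1)$ matrices over $K$, so that $\mathcal{RB}_1$ is an algebraic subset of $M_{n+1}(K)$; likewise $\{0,-1\}\times\mathcal{P}$ is an algebraic subset of $K\times M_n(K)$. ''Isomorphic'' means isomorphic as algebraic sets (varieties) over $K$: there is a bijection which, together with its inverse, is given by polynomials in the matrix entries (coordinates). *)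

(* Defs.v *)
From HB Require Import structures.
From mathcomp Require Import all_boot all_order all_algebra.
From mathcomp Require Import boolp.
From mathcomp Require Import mpoly.

Set Implicit Arguments.
Unset Strict Implicit.
Unset Printing Implicit Defensive.

Import GRing.Theory.
Local Open Scope ring_scope.

Definition ideal_prod (A : comNzRingType) (I J : A -> Prop) (p : A) : Prop :=
  exists s : seq (A * A),
    (forall z, z \in s -> I z.1 /\ J z.2) /\ p = \sum_(z <- s) z.1 * z.2.

Definition idealX (K : fieldType) (n : nat) (p : {mpoly K[n]}) : Prop :=
  exists g : 'I_n -> {mpoly K[n]}, p = \sum_(i < n) g i * 'X_i.

(* [{ideal_quot _}] asks for a boolean predicate. *)
Definition idealX2 (K : fieldType) (n : nat) : pred {mpoly K[n]} :=
  fun p => `[< ideal_prod (@idealX K n) (@idealX K n) p >].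

Section IdealX2.
Variables (K : fieldType) (n : nat).
Implicit Types p q : {mpoly K[n]}.

(* The exponents of the monomials [1, x_1, ..., x_n]. *)
Definition low_mnm (j : 'I_n.+1) : 'X_{1..n} :=
  if unlift ord0 j is Some i then U_(i)%MM else 0%MM.

Lemma low_mnm_inj : injective low_mnm.
Proof.
move=> i j; rewrite /low_mnm.
case: unliftP => [i' ->|->]; case: unliftP => [j' ->|->] //.
- by move/eqP; rewrite eq_mnm1 => /eqP ->.
- by move/eqP; rewrite mnm1_eq0.
- by move/esym/eqP; rewrite mnm1_eq0.
Qed.

Lemma low_mnmP m : reflect (exists j, m = low_mnm j) (mdeg m < 2)%N.
Proof.
apply: (iffP idP) => [|[j ->]]; last first.
  by rewrite /low_mnm; case: unliftP => *; rewrite ?mdeg1 ?mdeg0.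
rewrite ltnS leq_eqVlt => /orP[/mdeg1P[i /eqP ->]|].
  by exists (lift ord0 i); rewrite /low_mnm liftK.
rewrite ltnS leqn0 mdeg_eq0 => /eqP ->.
by exists ord0; rewrite /low_mnm unlift_none.
Qed.

Lemma mcoeffU_mul p q i :
  (p * q)@_U_(i) = p@_U_(i) * q@_0%MM + p@_0%MM * q@_U_(i).
Proof.
have dE r : r@_U_(i) = (r^`M(i))@_0%MM.
  by rewrite mcoeff_deriv add0m mnm0E.
by rewrite !dE mderivM mcoeffD !rmorphM.
Qed.

Lemma idealX_mcoeff0 p : idealX p -> p@_0%MM = 0.
Proof.
case=> g ->; rewrite raddf_sum big1 //= => i _.
by rewrite rmorphM /= mcoeffX mnm1_eq0 mulr0.
Qed.

Lemma mnm_gt0 (m : 'X_{1..n}) :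
  (0 < mdeg m)%N -> exists i m', m = (m' + U_(i))%MM.
Proof.
rewrite lt0n => m0; have [i mi|m0'] := pickP (fun i => m i != 0%N); last first.
  case/negP: m0; rewrite mdeg_eq0; apply/eqP/mnmP => i.
  by rewrite mnm0E; apply/eqP; move: (m0' i) => /negbFE.
exists i, (m - U_(i))%MM; rewrite submK //.
by apply/mnm_lepP => j; rewrite mnm1E; case: eqP => // <-; rewrite lt0n.
Qed.

Lemma idealX_mulX p i : idealX (p * 'X_i).
Proof.
exists (fun j => if j == i then p else 0).
by rewrite (bigD1 i) //= eqxx big1 ?addr0 // => j /negbTE ->; rewrite mul0r.
Qed.

Lemma idealX2P p : reflect (forall j, p@_(low_mnm j) = 0) (p \in @idealX2 K n).
Proof.
apply: (iffP (asboolP _)) => [[s [sI ->]] j|pl].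
  rewrite raddf_sum big_seq big1 //= => z /sI[/idealX_mcoeff0 z1 /idealX_mcoeff0 z2].
  rewrite /low_mnm; case: unlift => [i|].
    by rewrite mcoeffU_mul z1 z2 mulr0 mul0r addr0.
  by rewrite rmorphM /= z1 mul0r.
suff H (s : seq 'X_{1..n}) : (forall m, m \in s -> (1 < mdeg m)%N) ->
    ideal_prod (@idealX K n) (@idealX K n) (\sum_(m <- s) p@_m *: 'X_[m]).
  rewrite (mpolyE p); apply: H => m; rewrite mcoeff_msupp ltnNge -ltnS => pm.
  by apply/negP => /low_mnmP[j mj]; rewrite mj pl eqxx in pm.
elim: s => [|m s IH] ms; first by exists [::]; rewrite !big_nil.
have [|t [tI st]] := IH; first by move=> m' m's; apply: ms; rewrite inE m's orbT.
have m2 : (1 < mdeg m)%N by apply: ms; rewrite mem_head.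
have [|i [m' mE]] := @mnm_gt0 m; first exact: ltnW.
have [|j [m'' m'E]] := @mnm_gt0 m'.
  by move: m2; rewrite mE mdegD mdeg1 addn1.
exists ((p@_m *: 'X_[m''] * 'X_j, 1 * 'X_i) :: t); split => [z|].
  rewrite inE => /orP[/eqP ->/=|/tI //].
  by split; apply: idealX_mulX.
by rewrite !big_cons st /= mul1r mE m'E !mpolyXD -!scalerAl.
Qed.

Lemma idealX2_idealr : idealr_closed (@idealX2 K n).
Proof.
split.
- by apply/idealX2P => j; rewrite mcoeff0.
- apply/negP => /idealX2P /(_ ord0).
  by rewrite /low_mnm unlift_none mcoeff1 eqxx => /eqP; rewrite oner_eq0.
- move=> a u v /idealX2P ul /idealX2P vl; apply/idealX2P => j.
  have u0 : u@_0%MM = 0 by have := ul ord0; rewrite /low_mnm unlift_none.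
  rewrite mcoeffD vl addr0; have := ul j; rewrite /low_mnm.
  case: unlift => [i|] ui; first by rewrite mcoeffU_mul ui u0 !mulr0 addr0.
  by rewrite rmorphM /= u0 mulr0.
Qed.

HB.instance Definition _ :=
  isIdealr.Build {mpoly K[n]} (@idealX2 K n) idealX2_idealr.

End IdealX2.

Definition idealrX2 (K : fieldType) (n : nat) : idealr {mpoly K[n]} :=
  Idealr.clone _ (@idealX2 K n) _.

Definition truncalg (K : fieldType) (n : nat) : Type :=
  {ideal_quot (idealrX2 K n)}.

Section TruncAlg.
Variables (K : fieldType) (n : nat).
Local Notation R := (truncalg K n).

HB.instance Definition _ :=
  GRing.ComNzRing.copy R {ideal_quot (idealrX2 K n)}.

Definition truncpi (p : {mpoly K[n]}) : R :=
  (\pi_{ideal_quot (idealrX2 K n)} p)%qT.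

Lemma truncpi_zmod : zmod_morphism truncpi.
Proof. exact: (rmorphB \pi_{ideal_quot (idealrX2 K n)}%qT). Qed.
Lemma truncpi_monoid : monoid_morphism truncpi.
Proof.
split; first exact: (rmorph1 \pi_{ideal_quot (idealrX2 K n)}%qT).
exact: (rmorphM \pi_{ideal_quot (idealrX2 K n)}%qT).
Qed.
HB.instance Definition _ := GRing.isZmodMorphism.Build _ _ truncpi truncpi_zmod.
HB.instance Definition _ :=
  GRing.isMonoidMorphism.Build _ _ truncpi truncpi_monoid.

Definition trunc_scale (a : K) (x : R) : R := truncpi a%:MP * x.

Fact trunc_scalerA a b v :
  trunc_scale a (trunc_scale b v) = trunc_scale (a * b) v.
Proof. by rewrite /trunc_scale mulrA -rmorphM -mpolyCM. Qed.
Fact trunc_scale1r : left_id 1 trunc_scale.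
Proof. by move=> v; rewrite /trunc_scale mpolyC1 rmorph1 mul1r. Qed.
Fact trunc_scalerDr : right_distributive trunc_scale +%R.
Proof. by move=> a u v; rewrite /trunc_scale mulrDr. Qed.
Fact trunc_scalerDl v : {morph trunc_scale^~ v : a b / a + b}.
Proof. by move=> a b; rewrite /trunc_scale mpolyCD rmorphD mulrDl. Qed.
HB.instance Definition _ := GRing.Zmodule_isLmodule.Build K R
  trunc_scalerA trunc_scale1r trunc_scalerDr trunc_scalerDl.

Fact trunc_scalerAl (a : K) (u v : R) : a *: (u * v) = (a *: u) * v.
Proof. exact: mulrA. Qed.
HB.instance Definition _ := GRing.Lmodule_isLalgebra.Build K R trunc_scalerAl.
HB.instance Definition _ := GRing.Lalgebra_isComAlgebra.Build K R.

Lemma truncpi_scalable : scalable truncpi.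
Proof. by move=> a p; rewrite -mul_mpolyC rmorphM. Qed.
HB.instance Definition _ := GRing.isScalable.Build K _ _ _ truncpi truncpi_scalable.

Lemma truncpi_eq p q :
  (truncpi p == truncpi q) = (p - q \in @idealX2 K n).
Proof. by rewrite Quotient.idealrBE. Qed.

Definition trunc_v2r (x : R) : 'rV[K]_n.+1 :=
  \row_j (repr (x : {ideal_quot (idealrX2 K n)}))@_(low_mnm j).

Lemma trunc_v2r_pi p : trunc_v2r (truncpi p) = \row_j p@_(low_mnm j).
Proof.
apply/rowP => j; rewrite !mxE; apply/eqP; rewrite -subr_eq0 -mcoeffB.
apply/eqP; move: j; apply/idealX2P.
by rewrite -truncpi_eq /truncpi reprK.
Qed.

Lemma truncpi_surj (x : R) : exists p, x = truncpi p.
Proof.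
by exists (repr (x : {ideal_quot (idealrX2 K n)})); rewrite /truncpi reprK.
Qed.

Lemma trunc_v2r_linear : linear trunc_v2r.
Proof.
move=> a x y; have [p ->] := truncpi_surj x; have [q ->] := truncpi_surj y.
rewrite -linearP !trunc_v2r_pi; apply/rowP => j.
by rewrite !mxE mcoeffD mcoeffZ.
Qed.

Definition trunc_r2v (u : 'rV[K]_n.+1) : R :=
  truncpi (\sum_j u 0 j *: 'X_[low_mnm j]).

Lemma trunc_low_mcoeff (u : 'rV[K]_n.+1) j :
  (\sum_i u 0 i *: 'X_[low_mnm i])@_(low_mnm j) = u 0 j.
Proof.
rewrite raddf_sum (bigD1 j) //= mcoeffZ mcoeffX eqxx mulr1 big1 ?addr0 // => i ij.
by rewrite mcoeffZ mcoeffX (inj_eq (@low_mnm_inj n)) (negbTE ij) mulr0.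
Qed.

Lemma trunc_r2vK : cancel trunc_r2v trunc_v2r.
Proof.
by move=> u; rewrite trunc_v2r_pi; apply/rowP => j; rewrite mxE trunc_low_mcoeff.
Qed.

Lemma trunc_v2rK : cancel trunc_v2r trunc_r2v.
Proof.
move=> x; have [p ->] := truncpi_surj x.
apply/eqP; rewrite truncpi_eq; apply/idealX2P => j.
by rewrite mcoeffB trunc_low_mcoeff trunc_v2r_pi mxE subrr.
Qed.

Fact trunc_vector_axiom : Vector.axiom n.+1 R.
Proof.
exists trunc_v2r; first exact: trunc_v2r_linear.
by exists trunc_r2v; [exact: trunc_v2rK|exact: trunc_r2vK].
Qed.
HB.instance Definition _ := Lmodule_hasFinDim.Build K R trunc_vector_axiom.

Definition xbar (i : 'I_n) : R := truncpi 'X_i.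

Definition stdbasis : n.+1.-tuple R := [tuple of 1 :: [tuple xbar i | i < n]].

Lemma stdbasisE (j : 'I_n.+1) : stdbasis`_j = truncpi 'X_[low_mnm j].
Proof.
rewrite /low_mnm; case: unliftP => [i ->|->] /=.
  rewrite -[LHS]/([tuple xbar i | i < n]`_i).
  by rewrite -tnth_nth tnth_mktuple.
by rewrite mpolyX0 rmorph1.
Qed.

Lemma stdbasis_basis : basis_of fullv stdbasis.
Proof.
have sumE (k : 'I_n.+1 -> K) :
    \sum_j k j *: stdbasis`_j = trunc_r2v (\row_j k j).
  rewrite /trunc_r2v linear_sum; apply: eq_bigr => j _.
  by rewrite linearZ mxE stdbasisE.
rewrite basisEfree subvf dimvf size_tuple leqnn !andbT.
apply/freeP => k; rewrite sumE => /(congr1 trunc_v2r).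
rewrite trunc_r2vK -(raddf0 truncpi) trunc_v2r_pi => /rowP H j.
by have := H j; rewrite !mxE mcoeff0.
Qed.

Lemma xbar_mul i j : xbar i * xbar j = 0.
Proof.
rewrite -rmorphM -(raddf0 truncpi); apply/eqP; rewrite truncpi_eq subr0.
apply/asboolP; exists [:: ('X_i, 'X_j)].
rewrite big_seq1; split=> // z; rewrite inE => /eqP -> /=.
by rewrite -['X_i]mul1r -['X_j]mul1r; split; apply: idealX_mulX.
Qed.

End TruncAlg.

Definition rota_baxter1 (A : pzRingType) (P : A -> A) : Prop :=
  forall x y, P x * P y = P (x * P y + P x * y + x * y).

Definition zero_locus (K : fieldType) (N : nat) (S : {mpoly K[N]} -> Prop)
    (x : 'rV[K]_N) : Prop :=
  forall p, S p -> p.@[x 0] = 0.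

Definition algebraic_set (K : fieldType) (N : nat) (X : 'rV[K]_N -> Prop) : Prop :=
  exists S : {mpoly K[N]} -> Prop, forall x, X x <-> zero_locus S x.

Definition poly_map (K : fieldType) (N M : nat) (f : 'rV[K]_N -> 'rV[K]_M) : Prop :=
  exists p : 'I_M -> {mpoly K[N]}, forall x, f x = \row_j (p j).@[x 0].

Definition alg_isomorphic (K : fieldType) (N M : nat)
    (X : 'rV[K]_N -> Prop) (Y : 'rV[K]_M -> Prop) : Prop :=
  [/\ algebraic_set X, algebraic_set Y &
    exists (f : 'rV[K]_N -> 'rV[K]_M) (g : 'rV[K]_M -> 'rV[K]_N),
      [/\ poly_map f, poly_map g,
          (forall x, X x -> Y (f x) /\ g (f x) = x) &
          (forall y, Y y -> X (g y) /\ f (g y) = y)]].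

(* The matrix of [P] in the basis [e]: [P e_j = \sum_i M i j *: e_i].
   ([passmx.mxof] would need a cast from [\dim {:V}] to [m], and transposes.) *)
Definition mx_in_basis (K : fieldType) (V : vectType K) (m : nat)
    (e : m.-tuple V) (P : 'End(V)) : 'M[K]_m :=
  \matrix_(i, j) coord e i (P e`_j).

(* The variety of Rota--Baxter operators of weight one, in the coordinates of
   [M_(n+1)(K)] listed by [mxvec]. *)
Definition RB1 (K : fieldType) (n : nat) (x : 'rV[K]_(n.+1 * n.+1)) : Prop :=
  exists2 P : 'End(truncalg K n),
    rota_baxter1 P & x = mxvec (mx_in_basis (stdbasis K n) P).

(* [{a} * {Q | Q^2 = Q}] inside [K * M_n(K)], the latter having coordinates
   first the scalar, then the entries of the matrix. *)
Definition idem_copy (K : fieldType) (n : nat) (a : K) (y : 'rV[K]_(1 + n * n)) :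
    Prop :=
  exists2 Q : 'M[K]_n, Q *m Q = Q & y = row_mx a%:M (mxvec Q).

Definition two_idem_copies (K : fieldType) (n : nat) (y : 'rV[K]_(1 + n * n)) :
    Prop :=
  idem_copy 0 y \/ idem_copy (-1) y.

Lemma idem_copies_disjoint (K : fieldType) (n : nat) (y : 'rV[K]_(1 + n * n)) :
  ~ (idem_copy 0 y /\ idem_copy (-1) y).
Proof.
case=> -[Q _ ->] [Q' _] /eq_row_mx[/matrixP/(_ 0 0)].
by rewrite !mxE /= => /esym/eqP; rewrite oppr_eq0 oner_eq0.
Qed.

(* Main.v *)
From HB Require Import structures.
Require Import Defs.
From mathcomp Require Import all_boot all_order all_algebra.
From mathcomp Require Import mpoly ring.

Set Implicit Arguments.
Unset Strict Implicit.
Unset Printing Implicit Defensive.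

Import GRing.Theory.
Local Open Scope ring_scope.

(** A Rota--Baxter operator of weight one on [R = K + V], with [V * V = 0], is
    the same thing as a linear map [P] with [P^2 = - P] that respects the
    decomposition [K + V], that is, [P = a + L] with [a] a scalar acting on [K]
    and [L] an endomorphism of [V] ([rota_baxter1P]).

    Given the identity, evaluating it at [x = y = u] in [V] and taking the
    constant term [c] of [P u] gives [c^2 = 2 c^2], so [P] maps [V] to [V].  At
    [x = 1], [y = u] it then reads [P (P u) = - P u].  Finally write
    [P 1 = a + v]; at [x = y = 1] it reads [a^2 + a = 0] in the component [K] and
    [v + 2 P v = 0] in the component [V].  Applying [P] to the latter and using
    [P (P v) = - P v] yields [P v = 0], hence [v = 0].  The converse is a direct
    computation with [a^2 = - a].

    In the basis [1, x_1, ..., x_n] the matrices in question are therefore the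
    block diagonal [M] with [M^2 = - M] ([RB1P]), i.e. the matrices [diag(a, L)]
    with [a^2 = - a] and [L^2 = - L]: so [a] is [0] or [-1], and [- L] is an
    arbitrary idempotent.  The isomorphism is [M |-> (a, - L)], which is linear
    in the entries, as is its inverse.

    Polynomiality is obtained by evaluating matrix expressions at the generic
    point, the row vector of the variables: matrix operations commute with
    evaluation morphisms, so the value at [x] of an expression in the entries is
    the image under evaluation at [x] of its value at the generic point. *)

(** * Rota--Baxter operators on a square-zero extension of a field *)

Section SquareZeroExtension.
Variables (K : fieldType) (A : comAlgType K) (eps : {scalar A}).
Hypothesis eps1 : eps 1 = 1.
(* This formula says that [eps] is multiplicative with a square-zero kernel:
   it is [(x - eps x) * (y - eps y) = 0] expanded. *)
Hypothesis mul_eps :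
  forall x y, x * y = eps x *: y + eps y *: x - (eps x * eps y)%:A.

Lemma eps_alg a : eps a%:A = a.
Proof. by rewrite scalarZ eps1 mulr1. Qed.

Lemma eps_mul x y : eps (x * y) = eps x * eps y.
Proof. by rewrite mul_eps raddfB raddfD /= !scalarZ eps1; ring. Qed.

Lemma mul_ker x u : eps u = 0 -> x * u = eps x *: u.
Proof. by move=> u0; rewrite mul_eps u0 mulr0 !scale0r addr0 subr0. Qed.

Lemma eps_split x : exists2 u, eps u = 0 & x = (eps x)%:A + u.
Proof.
exists (x - (eps x)%:A); last by rewrite addrC subrK.
by rewrite raddfB /= eps_alg subrr.
Qed.

Variable P : {linear A -> A}.

(** For [u] in the kernel, [u * P u = c u] with [c = eps (P u)], so the constant
    terms in the identity at [(u, u)] give [c^2 = 2 c^2]. *)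
Lemma rota_baxter1_ker :
  rota_baxter1 P -> forall u, eps u = 0 -> eps (P u) = 0.
Proof.
move=> RB u u0; have := congr1 eps (RB u u).
rewrite eps_mul (mulrC u (P u)) !(mul_ker _ u0) u0 scale0r addr0 -scalerDl.
rewrite !linearZ /= mulrDl => /eqP.
by rewrite eq_sym -subr_eq0 addrK mulf_eq0 orbb => /eqP.
Qed.

(** On a local algebra with square-zero maximal ideal the quadratic
    Rota--Baxter identity splits into [P^2 = - P] and the stability of both
    summands [K] and [ker eps]. *)
Lemma rota_baxter1P :
  rota_baxter1 P <->
  [/\ forall x, P (P x) = - P x, P 1 = (eps (P 1))%:A &
      forall u, eps u = 0 -> eps (P u) = 0].
Proof.
split=> [RB|[PP P1 Pker]].
  have Pker := rota_baxter1_ker RB.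
  have PPker u : eps u = 0 -> P (P u) = - P u.
    (* The identity at [(1, u)] is [a P u = P (P u) + a P u + P u]. *)
    move=> u0; have := RB 1 u.
    rewrite (mul_ker _ (Pker _ u0)) (mul_ker _ u0) !mul1r !raddfD /= linearZ /=.
    move=> /eqP; rewrite addrAC -{1}[eps _ *: _]add0r (inj_eq (addIr _)) eq_sym.
    by rewrite addr_eq0 => /eqP.
  have [v v0 P1] := eps_split (P 1); set a := eps (P 1) in P1 *.
  have Pa b : P b%:A = b *: P 1 by rewrite linearZ.
  (* The identity at [(1, 1)], all terms on one side and with [P 1] replaced
     by [a + v], is [(a^2 + a) + (v + 2 P v) = 0]. *)
  have /eqP := RB 1 1.
  rewrite mul1r !mulr1 mul_eps -/a !raddfD /= [in P (P 1)]P1 raddfD /= Pa.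
  rewrite [in X in X == _]P1 [in X in _ == X]P1.
  rewrite -subr_eq0.
  set Z := (X in X == 0).
  have Z2 : Z = - ((a * a + a)%:A + (v + (P v + P v))).
    rewrite /Z !scalerDr !scalerA !scalerDl; ring.
  rewrite {}Z2 oppr_eq0 => /eqP RB11.
  have aa : a * a + a = 0.
    have := congr1 eps RB11.
    by rewrite !raddfD /= eps_alg v0 (Pker _ v0) !addr0 raddf0.
  (* Applying [P] to [v + 2 P v = 0] gives [P v - 2 P v = 0], hence [v = 0]. *)
  have vE : v + (P v + P v) = 0 by rewrite -RB11 aa scale0r add0r.
  have Pv : P v = 0.
    have := congr1 P vE; rewrite !raddfD /= PPker // raddf0 => /eqP.
    by rewrite addrA subrr sub0r oppr_eq0 => /eqP.
  have v00 : v = 0 by rewrite -vE Pv !addr0.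
  have {}P1 : P 1 = a%:A by rewrite P1 v00 addr0.
  split=> // x; have [u u0 ->] := eps_split x.
  rewrite !raddfD /= (PPker _ u0) !Pa; congr (_ - _).
  rewrite linearZZ P1 Pa P1 !scalerA -scaleNr; congr (_ *: _).
  by rewrite -mulrN -mulrA; congr (_ * _); apply/eqP; rewrite -addr_eq0 aa.
move: P1; set a := eps (P 1) => P1.
have Pa b : P b%:A = (b * a)%:A by rewrite linearZ /= P1 scalerA.
have aa : a * a = - a.
  by have := congr1 eps (PP 1); rewrite P1 Pa -scaleNr !eps_alg.
move=> x y; have [u u0 ->] := eps_split x; have [w w0 ->] := eps_split y.
move: (eps x) (eps y) => s t.
have P_split b z : P (b%:A + z) = (b * a)%:A + P z by rewrite raddfD /= Pa.
have mul_split b c z z' : eps z = 0 -> eps z' = 0 ->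
    (b%:A + z) * (c%:A + z') = (b * c)%:A + (b *: z' + c *: z).
  move=> z0 z'0; rewrite mulrDl !mulrDr !mulr_algl mulr_algr (mul_ker _ z'0) z0.
  by rewrite scale0r addr0 scalerA addrA.
rewrite !P_split !mul_split ?Pker // !raddfD /= !Pa !linearZZ !PP.
rewrite !scalerN.
(* The components in [ker eps] already agree; those in [K] do as [a^2 = - a]. *)
have -> : s * a * (t * a) = s * (t * a) * a + s * a * t * a + s * t * a.
  by ring: aa.
rewrite !scalerDl.
ring.
Qed.
End SquareZeroExtension.

(** * Coordinates on the truncated polynomial algebra *)

Section TruncAlgCoord.
Variables (K : fieldType) (n : nat).
Local Notation e := (stdbasis K n).

Lemma coord_truncpi (p : {mpoly K[n]}) j : coord e j (truncpi p) = p@_(low_mnm j).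
Proof.
rewrite -[truncpi p]trunc_v2rK trunc_v2r_pi /trunc_r2v linear_sum /=.
under eq_bigr => i _ do rewrite linearZ /= -stdbasisE mxE.
by rewrite coord_sum_free // (basis_free (stdbasis_basis K n)).
Qed.

Lemma stdbasis_coordP (x y : truncalg K n) :
  (forall j, coord e j x = coord e j y) -> x = y.
Proof.
move=> xy; rewrite (coord_basis (stdbasis_basis K n) (memvf x)).
rewrite (coord_basis (stdbasis_basis K n) (memvf y)).
by apply: eq_bigr => j _; rewrite xy.
Qed.

Lemma low_mnm0 : low_mnm (ord0 : 'I_n.+1) = 0%MM.
Proof. by rewrite /low_mnm unlift_none. Qed.

Lemma coord_stdbasis1 j : coord e j 1 = (j == ord0)%:R.
Proof.
rewrite -[1](rmorph1 (@truncpi K n)) coord_truncpi mcoeff1 -low_mnm0.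
by rewrite (inj_eq (@low_mnm_inj n)).
Qed.

(** The constant coefficient is an augmentation whose kernel, spanned by the
    [xbar i], has square zero; the formula is the one required of [eps] above. *)
Lemma truncalg_mulE (x y : truncalg K n) :
  x * y = coord e ord0 x *: y + coord e ord0 y *: x
            - (coord e ord0 x * coord e ord0 y)%:A.
Proof.
have [p ->] := truncpi_surj x; have [q ->] := truncpi_surj y.
apply: stdbasis_coordP => j.
rewrite -rmorphM raddfB raddfD /= !linearZ /= !coord_truncpi coord_stdbasis1 low_mnm0.
rewrite /low_mnm; case: unliftP => [i ->|->].
  by rewrite mcoeffU_mul mulr0 subr0 addrC [X in X + _]mulrC [X in _ + X]mulrC; ring.
by rewrite rmorphM /=; ring.
Qed.
End TruncAlgCoord.

(** * Matrices of endomorphisms in a basis *)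

Section MxInBasis.
Variables (K : fieldType) (V : vectType K) (m : nat) (e : m.-tuple V).
Hypothesis eB : basis_of fullv e.

Lemma coord_mx_in_basis (P : 'End(V)) x i :
  coord e i (P x) = \sum_j mx_in_basis e P i j * coord e j x.
Proof.
rewrite {1}(coord_basis eB (memvf x)) !linear_sum /=; apply: eq_bigr => j _.
by rewrite !linearZ /= mxE mulrC.
Qed.

Lemma coord_basisE (i j : 'I_m) : coord e i e`_j = (i == j)%:R.
Proof. by rewrite coord_free ?(basis_free eB) // eq_sym. Qed.

Lemma mx_in_basis_comp (P Q : 'End(V)) :
  mx_in_basis e (P \o Q)%VF = mx_in_basis e P *m mx_in_basis e Q.
Proof.
apply/matrixP => i j; rewrite !mxE comp_lfunE coord_mx_in_basis.
by apply: eq_bigr => k _; rewrite !mxE.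
Qed.

Lemma mx_in_basisN (P : 'End(V)) : mx_in_basis e (- P) = - mx_in_basis e P.
Proof. by apply/matrixP => i j; rewrite !mxE opp_lfunE raddfN. Qed.

Lemma mx_in_basis_inj : injective (mx_in_basis e).
Proof.
move=> P Q PQ; apply/lfunP => x.
rewrite (coord_basis eB (memvf (P x))) (coord_basis eB (memvf (Q x))).
by apply: eq_bigr => i _; rewrite !coord_mx_in_basis PQ.
Qed.

Definition mx_fun (M : 'M[K]_m) (x : V) : V :=
  \sum_i (\sum_j M i j * coord e j x) *: e`_i.

Lemma mx_fun_linear M : linear (mx_fun M).
Proof.
move=> a x y; rewrite /mx_fun scaler_sumr -big_split; apply: eq_bigr => i _ /=.
rewrite scalerA -scalerDl mulr_sumr -big_split; congr (_ *: _).
by apply: eq_bigr => j _; rewrite raddfD /= scalarZ mulrDr mulrCA.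
Qed.
HB.instance Definition _ M := GRing.isSemilinear.Build K V V *:%R (mx_fun M)
  (GRing.semilinear_linear (mx_fun_linear M)).

Lemma mx_in_basis_surj M : exists P : 'End(V), mx_in_basis e P = M.
Proof.
exists (linfun (mx_fun M)); apply/matrixP => i j.
rewrite mxE lfunE /= coord_sum_free ?(basis_free eB) // (bigD1 j) //=.
rewrite coord_basisE eqxx mulr1 big1 ?addr0 // => k kj.
by rewrite coord_basisE (negbTE kj) mulr0.
Qed.
End MxInBasis.

(** * The matrices of Rota--Baxter operators *)

Section RotaBaxterMatrix.
Variables (K : fieldType) (n : nat).
Local Notation e := (stdbasis K n).
Local Notation eB := (stdbasis_basis K n).

Lemma ord0_lshift : (ord0 : 'I_n.+1) = lshift n (ord0 : 'I_1).
Proof. exact: val_inj. Qed.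

Lemma rshift_neq0 (j : 'I_n) : (rshift 1 j == ord0 :> 'I_n.+1) = false.
Proof. by []. Qed.

(** [P 1] is a scalar when the first column vanishes off the diagonal, and [P]
    preserves [V] when the first row does; so [rota_baxter1P] becomes a condition
    on the blocks of the matrix. *)
Lemma RB1P (x : 'rV[K]_(n.+1 * n.+1)) (M := vec_mx x : 'M_(1 + n)) :
  RB1 x <-> [/\ M *m M = - M, ursubmx M = 0 & dlsubmx M = 0].
Proof.
have coord1 (P : 'End(truncalg K n)) i : coord e i (P 1) = mx_in_basis e P i ord0.
  by rewrite mxE.
have RBP (P : 'End(truncalg K n)) (A := mx_in_basis e P : 'M_(1 + n)) :
    rota_baxter1 P <-> [/\ A *m A = - A, ursubmx A = 0 & dlsubmx A = 0].
  have -> : rota_baxter1 P <-> _ := @rota_baxter1P _ (truncalg K n)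
    (coord e ord0) (coord_stdbasis1 _ _) (@truncalg_mulE K n) P.
  split=> [[PP P1 Pker]|[AA Aur Adl]]; split.
  - have PPE : (P \o P)%VF = - P.
      by apply/lfunP => y; rewrite comp_lfunE opp_lfunE PP.
    by rewrite /A -[LHS](mx_in_basis_comp eB) PPE mx_in_basisN.
  - apply/matrixP => i j; rewrite !mxE ord1 -ord0_lshift.
    by apply: Pker; apply: etrans (coord_basisE eB ord0 (rshift 1 j)) _.
  - apply/matrixP => i j; rewrite !mxE ord1 -ord0_lshift.
    have := congr1 (coord e (rshift 1 i)) P1.
    by rewrite linearZ /= coord_stdbasis1 rshift_neq0 mulr0.
  - have PPE : (P \o P)%VF = - P.
      apply: (mx_in_basis_inj eB).
      by rewrite mx_in_basisN -[RHS]AA; exact: (mx_in_basis_comp eB).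
    by move=> y; have := comp_lfunE P P y; rewrite PPE opp_lfunE.
  - apply: stdbasis_coordP => i; rewrite linearZ /= !coord1 coord_stdbasis1.
    case: (split_ordP (i : 'I_(1 + n))) => [k|k] ->.
      by rewrite ord1 ord0_lshift eqxx mulr1.
    rewrite rshift_neq0 mulr0 ord0_lshift.
    by move/matrixP/(_ k ord0): Adl; rewrite !mxE.
  - move=> u u0; apply: etrans (coord_mx_in_basis eB P u ord0) _.
    rewrite (big_ord_recl n) u0 mulr0 add0r big1 // => j _.
    have -> : lift ord0 j = rshift 1 j by apply: val_inj.
    rewrite {1}ord0_lshift.
    by move/matrixP/(_ ord0 j): Aur; rewrite !mxE => ->; rewrite mul0r.
split=> [[P RBp xE]|H].
  by rewrite /M xE mxvecK; apply/RBP.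
have [P PM] := mx_in_basis_surj eB M.
exists P; last by rewrite PM vec_mxK.
by apply/RBP; rewrite PM.
Qed.
End RotaBaxterMatrix.

(** * Polynomial maps and algebraic sets from the generic point *)

Section GenericPoint.
Variable K : fieldType.

Definition generic_point N : 'rV[{mpoly K[N]}]_N := \row_j 'X_j.

Lemma map_generic_point N (x : 'rV[K]_N) :
  map_mx (meval (x 0)) (generic_point N) = x.
Proof. by apply/rowP => j; rewrite !mxE mevalXU. Qed.

Lemma poly_map_mx N M (f : 'rV[K]_N -> 'rV[K]_M) (A : 'rV[{mpoly K[N]}]_M) :
  (forall x, f x = map_mx (meval (x 0)) A) -> poly_map f.
Proof.
by move=> fA; exists (A 0) => x; rewrite fA; apply/rowP => j; rewrite !mxE.
Qed.

Lemma algebraic_set_mx N p q (A : 'M[{mpoly K[N]}]_(p, q)) (X : 'rV[K]_N -> Prop) :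
  (forall x, X x <-> map_mx (meval (x 0)) A = 0) -> algebraic_set X.
Proof.
move=> XA; exists (fun a => exists i j, a = A i j) => x; rewrite XA; split.
  by move=> /matrixP A0 _ [i [j ->]]; have := A0 i j; rewrite !mxE.
by move=> A0; apply/matrixP => i j; rewrite !mxE; apply: A0; exists i, j.
Qed.

Lemma algebraic_setI N (X Y : 'rV[K]_N -> Prop) :
  algebraic_set X -> algebraic_set Y -> algebraic_set (fun x => X x /\ Y x).
Proof.
move=> [S XS] [T YT]; exists (fun p => S p \/ T p) => x; rewrite XS YT.
by split=> [[xS xT] p []|xST]; [exact: xS|exact: xT|split=> p ?; apply: xST; tauto].
Qed.
End GenericPoint.

(** * The isomorphism *)

Section Isomorphism.
Variable n : nat.

(** The maps of this part are defined over any ring, so as to apply both to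
    points over [K] and to the generic point over the polynomial ring. *)
Definition RB_to_idem (R : pzRingType) (x : 'rV[R]_(n.+1 * n.+1)) : 'rV[R]_(1 + n * n) :=
  let M : 'M_(1 + n) := vec_mx x in row_mx (ulsubmx M) (mxvec (- drsubmx M)).

Definition diag_of_idem (R : pzRingType) (y : 'rV[R]_(1 + n * n)) : 'M[R]_(1 + n) :=
  block_mx (lsubmx y) 0 0 (- vec_mx (rsubmx y)).

Definition idem_to_RB (R : pzRingType) (y : 'rV[R]_(1 + n * n)) : 'rV[R]_(n.+1 * n.+1) :=
  mxvec (diag_of_idem y).

Lemma map_RB_to_idem (R S : pzRingType) (h : {rmorphism R -> S}) x :
  map_mx h (RB_to_idem x) = RB_to_idem (map_mx h x).
Proof.
by rewrite /RB_to_idem map_row_mx map_mxvec map_mxN -map_vec_mx map_ulsubmx map_drsubmx.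
Qed.

Lemma map_diag_of_idem (R S : pzRingType) (h : {rmorphism R -> S}) y :
  map_mx h (diag_of_idem y) = diag_of_idem (map_mx h y).
Proof.
by rewrite /diag_of_idem map_block_mx !map_mx0 map_mxN map_vec_mx map_lsubmx map_rsubmx.
Qed.

Lemma map_idem_to_RB (R S : pzRingType) (h : {rmorphism R -> S}) y :
  map_mx h (idem_to_RB y) = idem_to_RB (map_mx h y).
Proof. by rewrite /idem_to_RB map_mxvec map_diag_of_idem. Qed.

Lemma idem_to_RBK (R : pzRingType) : cancel (@idem_to_RB R) (@RB_to_idem R).
Proof.
move=> y; rewrite /RB_to_idem /idem_to_RB mxvecK block_mxKul block_mxKdr opprK.
by rewrite vec_mxK hsubmxK.
Qed.

Lemma RB_to_idemK (R : pzRingType) (x : 'rV[R]_(n.+1 * n.+1))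
    (M := vec_mx x : 'M_(1 + n)) :
  ursubmx M = 0 -> dlsubmx M = 0 -> idem_to_RB (RB_to_idem x) = x.
Proof.
move=> ur dl; rewrite /RB_to_idem /idem_to_RB /diag_of_idem row_mxKl row_mxKr.
by rewrite mxvecK opprK -{1}ur -dl submxK vec_mxK.
Qed.

(** The pairs [(a, Q)] with [Q] idempotent and [a] in [{0, -1}] are those for which
    [diag(a, - Q)] is the opposite of an idempotent, because [a^2 = - a] has only
    the roots [0] and [-1].  This makes the disjoint union algebraic, and lets the
    two varieties be compared by a single matrix equation. *)
Lemma two_idem_copiesP (K : fieldType) (y : 'rV[K]_(1 + n * n)) (D := diag_of_idem y) :
  two_idem_copies y <-> D *m D = - D.
Proof.
have idem_copyP a : idem_copy a y <->
    lsubmx y = a%:M /\ vec_mx (rsubmx y) *m vec_mx (rsubmx y) = vec_mx (rsubmx y).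
  split=> [[Q QQ ->]|[ya yQ]]; first by rewrite row_mxKl row_mxKr mxvecK.
  by exists (vec_mx (rsubmx y)); rewrite // vec_mxK -ya hsubmxK.
rewrite /two_idem_copies !idem_copyP /D /diag_of_idem mulmx_block opp_block_mx.
rewrite !(mulmx0, mul0mx, addr0, add0r) mulNmx mulmxN opprK oppr0.
rewrite [lsubmx y]mx11_scalar; set a := lsubmx y 0 0.
rewrite -scalar_mxM -raddfN /=.
have scalar_mx1P c : a%:M = c%:M :> 'M_1 <-> a = c.
  by split=> [/matrixP/(_ 0 0)|-> //]; rewrite !mxE.
rewrite !scalar_mx1P.
have aE : (a * a = - a) <-> (a = 0 \/ a = -1).
  split=> [/eqP|[]->]; rewrite ?mulr0 ?oppr0 ?mulrNN ?mulr1 ?opprK //.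
  by rewrite -addr_eq0 -{3}[a]mulr1 -mulrDr mulf_eq0 addr_eq0 => /orP[]/eqP; tauto.
split=> [[[-> QQ]|[-> QQ]]|/eq_block_mx[/matrixP/(_ 0 0)]].
- by rewrite mulr0 !oppr0 opprK QQ.
- by rewrite mulrNN mulr1 oppr0 !opprK QQ.
rewrite !mxE !mulr1n opprK => aa _ _ QQ.
by case/aE: aa => ->; [left|right].
Qed.

End Isomorphism.

Theorem corollary4p4 (K : fieldType) (charK0 : [pchar K] =i pred0)
  (n : nat) (n_ge1 : (1 <= n)%N) :
  alg_isomorphic (@RB1 K n) (@two_idem_copies K n).
Proof.
have X := map_generic_point; split.
- (* The entries of [M^2 + M] and of the two off-diagonal blocks of the generic
     matrix are equations for the variety. *)
  pose M : 'M[{mpoly K[_]}]_(1 + n) := vec_mx (generic_point K (n.+1 * n.+1)).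
  have: algebraic_set (fun x : 'rV[K]_(n.+1 * n.+1) => let M := vec_mx x : 'M_(1 + n) in
      M *m M + M = 0 /\ ursubmx M = 0 /\ dlsubmx M = 0).
    apply: algebraic_setI; last apply: algebraic_setI.
    + apply: (@algebraic_set_mx _ _ _ _ (M *m M + M)) => x.
      by rewrite map_mxD map_mxM map_vec_mx X.
    + apply: (@algebraic_set_mx _ _ _ _ (ursubmx M)) => x.
      by rewrite map_ursubmx map_vec_mx X.
    + apply: (@algebraic_set_mx _ _ _ _ (dlsubmx M)) => x.
      by rewrite map_dlsubmx map_vec_mx X.
  case=> S XS; exists S => x; rewrite -XS RB1P //=.
  split=> [[MM -> ->]|[/eqP MM [-> ->]]]; first by rewrite MM addNr.
  by split=> //; apply/eqP; rewrite -addr_eq0.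
- pose D := diag_of_idem (generic_point K (1 + n * n)).
  apply: (@algebraic_set_mx _ _ _ _ (D *m D + D)) => y.
  rewrite map_mxD map_mxM map_diag_of_idem X two_idem_copiesP.
  by split=> [->|/eqP]; [rewrite addNr|rewrite addr_eq0 => /eqP].
exists (@RB_to_idem n K), (@idem_to_RB n K); split.
- apply: poly_map_mx (RB_to_idem (generic_point K _)) _ => x.
  by rewrite map_RB_to_idem X.
- apply: poly_map_mx (idem_to_RB (generic_point K _)) _ => y.
  by rewrite map_idem_to_RB X.
- move=> x /RB1P[MM ur dl]; split; last exact: RB_to_idemK.
  apply/two_idem_copiesP; have := congr1 vec_mx (RB_to_idemK ur dl).
  by rewrite mxvecK => ->.
- move=> y /two_idem_copiesP DD; split; last exact: idem_to_RBK.
  by apply/RB1P; rewrite mxvecK block_mxKur block_mxKdl.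
Qed.
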